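(* Let $\underline{A}\in\mathbb{R}^{n\times n}$ be a symmetric negative-definite matrix. If $P\in\mathbb{R}^{n\times n}$ is a (not necessarily symmetric) matrix satisfying $$\underline{A}P+P^T\underline{A}\prec\mathbf{0},$$ then every eigenvalue $\lambda_i(P)$, $i\in\{1,2,\dots,n\}$, of $P$ satisfies $\operatorname{Re}(\lambda_i(P))>0$, and hence $\operatorname{trace}(P)>0$.
   Context: For a real square matrix $M$, $M\prec\mathbf{0}$ means that $M$ is symmetric and negative-definite. $\lambda_1(P),\dots,\lambda_n(P)$ denote the (possibly complex) eigenvalues of $P$. *)

(* Defs.v *)
From mathcomp Require Import all_boot all_order all_algebra.
From mathcomp Require Export reals complex.
Set Implicit Arguments.
Unset Strict Implicit.
Unset Printing Implicit Defensive.

Import GRing.Theory Num.Theory.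
Local Open Scope ring_scope.

Definition neg_def (R : realType) (n : nat) (M : 'M[R]_n) : Prop :=
  M^T = M /\ forall x : 'cV[R]_n, x != 0 -> (x^T *m M *m x) 0 0 < 0.

(* The complex eigenvalues of a real matrix are those of its image over R[i].
   [eigenvalue] is phrased with row vectors (v *m P = z *: v); a matrix and its
   transpose have the same characteristic polynomial, so these are also the
   eigenvalues for column vectors. *)
Definition complex_eigenvalue (R : realType) (n : nat) (P : 'M[R]_n)
    (z : R[i]) : Prop :=
  eigenvalue (map_mx (real_complex R) P) z.

(* Main.v *)
Require Import Defs.
From mathcomp Require Import all_boot all_order all_algebra.
From mathcomp Require Import reals complex.
Set Implicit Arguments.
Unset Strict Implicit.
Unset Printing Implicit Defensive.
Import Order.TTheory GRing.Theory Num.Theory.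
Local Open Scope ring_scope.

(** This is Lyapunov's argument.  Let [w = x + i y] be a complex eigenvector of
    [P] for [z = a + i b]; then [P x = a x - b y] and [P y = b x + a y].  Since
    [A] is symmetric, the quadratic form of [A P + P^T A] at a real vector [u]
    is twice [u^T A (P u)].  Summing over [u = x] and [u = y], the cross terms in
    [b] cancel, again because [A] is symmetric, and what is left is
      [Q x + Q y = 2 a (x^T A x + y^T A y)],
    where [Q] is the form of [A P + P^T A].  As [x] and [y] are not both zero,
    the left-hand side and the bracket are both negative, so [a > 0]
    ([lyapunov_eigenvalue_Re_gt0]).

    Over the algebraically closed field [R[i]] the trace of [P] is the sum of
    [n] eigenvalues ([trace_sum_eigenvalues]).  Its real part is a sum of [n]
    positive numbers, with [n > 0]. *)

Lemma char_poly_trmx (R : comNzRingType) (n : nat) (P : 'M[R]_n) :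
  char_poly P^T = char_poly P.
Proof.
rewrite /char_poly -[RHS]det_tr; congr (\det _).
by apply/matrixP => i j; rewrite !mxE eq_sym.
Qed.

(** Eigenvalues are defined through row eigenvectors; transposition keeps the
    characteristic polynomial and turns rows into columns. *)
Lemma eigenvalue_col_vector (F : fieldType) (n : nat) (P : 'M[F]_n) (z : F) :
  eigenvalue P z -> exists2 w : 'cV[F]_n, P *m w = z *: w & w != 0.
Proof.
rewrite eigenvalue_root_char -char_poly_trmx -eigenvalue_root_char.
case/eigenvalueP => v vP v_neq0; exists v^T; last by rewrite trmx_eq0.
by apply: trmx_inj; rewrite trmx_mul linearZ /= trmxK.
Qed.

(** The characteristic polynomial splits over a closed field, so its
    subleading coefficient, which is minus the trace, is minus the sum of its
    roots counted with multiplicity. *)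
Lemma trace_sum_eigenvalues (F : closedFieldType) (n : nat) (P : 'M[F]_n) :
  (0 < n)%N ->
  exists2 s : seq F, size s = n /\ \tr P = \sum_(z <- s) z
                   & {in s, forall z, eigenvalue P z}.
Proof.
move=> n_gt0; have [s] := closed_field_poly_normal (char_poly P).
rewrite (monicP (char_poly_monic P)) scale1r => charE.
have size_s : size s = n.
  by apply: succn_inj; rewrite -(size_char_poly P) charE size_prod_XsubC.
exists s => [|z z_in_s]; last first.
  by rewrite eigenvalue_root_char charE root_prod_XsubC.
split=> //; apply: oppr_inj; rewrite -char_poly_trace // charE -size_s.
by rewrite coefPn_prod_XsubC // size_s -lt0n.
Qed.

Lemma Re_sum (R : realType) (I : Type) (r : seq I) (F : I -> R[i]) :
  complex.Re (\sum_(i <- r) F i) = \sum_(i <- r) complex.Re (F i).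
Proof. by apply: (big_morph (@complex.Re R)) => // -[a b] [c d]. Qed.

Lemma Im_sum (R : realType) (I : Type) (r : seq I) (F : I -> R[i]) :
  complex.Im (\sum_(i <- r) F i) = \sum_(i <- r) complex.Im (F i).
Proof. by apply: (big_morph (@complex.Im R)) => // -[a b] [c d]. Qed.

Lemma map_mx_Re_real_mul (R : realType) (m n p : nat)
    (P : 'M[R]_(m, n)) (W : 'M[R[i]]_(n, p)) :
  map_mx (@complex.Re R) (map_mx (real_complex R) P *m W) =
  P *m map_mx (@complex.Re R) W.
Proof.
apply/matrixP => i j; rewrite !mxE Re_sum; apply: eq_bigr => k _.
by rewrite !mxE; case: (W k j) => c d /=; rewrite mul0r subr0.
Qed.

Lemma map_mx_Im_real_mul (R : realType) (m n p : nat)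
    (P : 'M[R]_(m, n)) (W : 'M[R[i]]_(n, p)) :
  map_mx (@complex.Im R) (map_mx (real_complex R) P *m W) =
  P *m map_mx (@complex.Im R) W.
Proof.
apply/matrixP => i j; rewrite !mxE Im_sum; apply: eq_bigr => k _.
by rewrite !mxE; case: (W k j) => c d /=; rewrite mul0r addr0.
Qed.

(** These are the real and imaginary parts of [P w = z w] for [w = x + i y],
    which can be separated because [P] has real entries. *)
Lemma complex_eigenvalue_real_pair (R : realType) (n : nat) (P : 'M[R]_n)
    (z : R[i]) :
  complex_eigenvalue P z ->
  exists x y : 'cV[R]_n,
    [/\ P *m x = complex.Re z *: x - complex.Im z *: y,
        P *m y = complex.Im z *: x + complex.Re z *: y
      & (x != 0) || (y != 0)].
Proof.
case/eigenvalue_col_vector => w Pw w_neq0.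
exists (map_mx (@complex.Re R) w), (map_mx (@complex.Im R) w); split.
- rewrite -map_mx_Re_real_mul Pw; apply/matrixP => i j; rewrite !mxE.
  by case: z {Pw} (w i j) => a b [c d].
- rewrite -map_mx_Im_real_mul Pw; apply/matrixP => i j; rewrite !mxE.
  by case: z {Pw} (w i j) => a b [c d] /=; rewrite addrC.
rewrite -negb_and; apply: contra w_neq0 => /andP[/eqP Re0 /eqP Im0].
apply/eqP/matrixP => i j; apply/eqP.
move/matrixP/(_ i j): Re0; move/matrixP/(_ i j): Im0.
by rewrite !mxE eq_complex /= => -> ->; rewrite !eqxx.
Qed.

Lemma neg_def_le0 (R : realType) (n : nat) (M : 'M[R]_n) (x : 'cV[R]_n) :
  neg_def M -> (x^T *m M *m x) 0 0 <= 0.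
Proof.
case=> _ M_neg; have [-> | /M_neg/ltW //] := eqVneq x 0.
by rewrite mulmx0 mxE.
Qed.

Lemma neg_def_sum_lt0 (R : realType) (n : nat) (M : 'M[R]_n)
    (x y : 'cV[R]_n) :
  neg_def M -> (x != 0) || (y != 0) ->
  (x^T *m M *m x) 0 0 + (y^T *m M *m y) 0 0 < 0.
Proof.
move=> M_neg /orP[] /(proj2 M_neg) lt0.
- by rewrite ltr_wnDr ?neg_def_le0.
- by rewrite ltr_wnDl ?neg_def_le0.
Qed.

Lemma bilinear_form_sym (R : comNzRingType) (n : nat) (A : 'M[R]_n)
    (x y : 'cV[R]_n) :
  A^T = A -> (x^T *m A *m y) 0 0 = (y^T *m A *m x) 0 0.
Proof.
move=> A_sym; rewrite -[in LHS](trmxK (x^T *m A *m y)) mxE.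
by rewrite !trmx_mul trmxK A_sym mulmxA.
Qed.

Lemma lyapunov_form (R : comNzRingType) (n : nat) (A P : 'M[R]_n)
    (x : 'cV[R]_n) :
  A^T = A ->
  (x^T *m (A *m P + P^T *m A) *m x) 0 0 = (x^T *m A *m (P *m x)) 0 0 *+ 2.
Proof.
move=> A_sym; rewrite mulmxDr mulmxDl mxE mulr2n; congr (_ + _).
  by rewrite !mulmxA.
by rewrite [RHS]bilinear_form_sym // trmx_mul !mulmxA.
Qed.

Lemma lyapunov_eigenvalue_Re_gt0 (R : realType) (n : nat) (A P : 'M[R]_n)
    (z : R[i]) :
  neg_def A -> neg_def (A *m P + P^T *m A) -> complex_eigenvalue P z ->
  0 < complex.Re z.
Proof.
move=> A_neg AP_neg /complex_eigenvalue_real_pair[x [y [Px Py xy_neq0]]].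
have A_sym := proj1 A_neg.
have := neg_def_sum_lt0 AP_neg xy_neq0.
have formA_lt0 := neg_def_sum_lt0 A_neg xy_neq0.
rewrite !lyapunov_form // -mulrnDl pmulrn_llt0 // Px Py.
rewrite mulmxBr mulmxDr -!scalemxAr.
rewrite ![fun_of_matrix (_ + _) 0 0]mxE [fun_of_matrix (- _) 0 0]mxE.
rewrite ![fun_of_matrix (_ *: _) 0 0]mxE.
(* The two cross terms carry opposite signs of [Im z]. *)
rewrite (bilinear_form_sym y x A_sym) addrA subrK -mulrDr.
by rewrite nmulr_llt0.
Qed.

Theorem proposition1 (R : realType) (n : nat) (n_gt0 : (0 < n)%N)
    (A P : 'M[R]_n) (A_neg : neg_def A)
    (AP_neg : neg_def (A *m P + P^T *m A)) :
  (forall z : R[i], complex_eigenvalue P z -> 0 < complex.Re z) /\ 0 < \tr P.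
Proof.
have Re_gt0 z := @lyapunov_eigenvalue_Re_gt0 R n A P z A_neg AP_neg.
split=> //.
have [s [size_s trE] s_eigen] :=
  trace_sum_eigenvalues (map_mx (real_complex R) P) n_gt0.
have -> : \tr P = \sum_(z <- s) complex.Re z.
  by rewrite -Re_sum -trE trace_map_mx.
case: s size_s s_eigen {trE} => [n0|z s _ s_eigen]; first by rewrite -n0 in n_gt0.
rewrite big_cons ltr_wpDr ?Re_gt0 //; last by apply/s_eigen/mem_head.
rewrite big_seq sumr_ge0 // => u u_in_s; apply/ltW/Re_gt0/s_eigen.
by rewrite inE u_in_s orbT.
Qed.
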